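(* Both $\mathcal{M}$ and $\mathcal{X}$ are strongly infinite-dimensional, and in particular they are not countable-dimensional, i.e. neither of them can be represented as a union of countably many finite-dimensional subspaces.
   Context: Dimension: $\dim$ is the covering dimension. A family $\mathcal{U}$ of subsets of a space $X$ has order at most $k$ if every point of $X$ lies in at most $k+1$ distinct elements of $\mathcal{U}$. For a metric space $X$ and an integer $k\ge 0$, $\dim X\le k$ means that every open cover of $X$ has an open refinement that covers $X$ and has order at most $k$; $X$ is finite-dimensional if $\dim X\le k$ for some $k$. Strong infinite-dimensionality: a partition between two disjoint closed subsets $A,B$ of a space $X$ is a closed set $L\subset X$ such that $X\setminus L=U\cup W$ for disjoint open sets $U\supset A$, $W\supset B$. A metric space $X$ is strongly infinite-dimensional if there is an infinite sequence $(A_1,B_1),(A_2,B_2),\dots$ of pairs of disjoint closed subsets of $X$ such that, whenever $L_i$ is a partition between $A_i$ and $B_i$ for each $i$, one has $\bigcap_{i=1}^\infty L_i\ne\emptyset$. Distortion: for metric spaces $(X,d_X)$, $(Y,d_Y)$ and a relation $R\subset X\times Y$, $\operatorname{dis} R=\sup\{|d_X(x_1,x_2)-d_Y(y_1,y_2)| : (x_1,y_1),(x_2,y_2)\in R\}$ (with $\operatorname{dis}\emptyset=0$). Gromov-Hausdorff space: a correspondence between $X$ and $Y$ is a relation $R\subset X\times Y$ whose projections to $X$ and to $Y$ are both surjective. The Gromov-Hausdorff distance is $d_{GH}(X,Y)=\frac12\inf_R \operatorname{dis} R$, the infimum over all correspondences $R$ between $X$ and $Y$. $\mathcal{M}$ is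 the metric space of isometry classes of non-empty compact metric spaces with the metric $d_{GH}$. Box metric space: a metric measure space $(X,d_X,\mu_X)$ is a complete separable metric space $(X,d_X)$ with a Borel probability measure $\mu_X$; one always assumes $X=\operatorname{supp}\mu_X$. Two metric measure spaces are mm-isomorphic if there is an isometry $f\colon \operatorname{supp}\mu_X\to\operatorname{supp}\mu_Y$ (onto) with $f_*\mu_X=\mu_Y$. $\Pi(\mu_X,\mu_Y)$ is the set of couplings, i.e. Borel measures on $X\times Y$ with marginals $\mu_X$ and $\mu_Y$. The box distance is $\square(X,Y)=\min_{\pi\in\Pi(\mu_X,\mu_Y)}\min_{S}\max\{1-\pi(S),\operatorname{dis}S\}$, where $S$ ranges over all closed subsets of $X\times Y$. $\mathcal{X}$ is the metric space of mm-isomorphism classes of metric measure spaces with the metric $\square$. *)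

(* Defs.v *)
From HB Require Import structures.
From mathcomp Require Import all_boot all_order all_algebra generic_quotient.
From mathcomp Require Import all_classical all_reals all_analysis.

Set Implicit Arguments.
Unset Strict Implicit.
Unset Printing Implicit Defensive.

Import Order.TTheory GRing.Theory Num.Theory.
Local Open Scope classical_set_scope.
Local Open Scope ring_scope.
Local Open Scope quotient_scope.
Local Open Scope card_scope.

Section Dimension.
Implicit Type T : topologicalType.

Definition open_cover T (U : set (set T)) :=
  U `<=` open /\ \bigcup_(A in U) A = setT.

Definition refines T (V U : set (set T)) :=
  forall B, V B -> exists2 A, U A & B `<=` A.

Definition order_le T (U : set (set T)) (k : nat) :=
  forall x, [set A | U A /\ A x] #<= `I_k.+1.

Definition dim_le T (k : nat) := forall U : set (set T), open_cover U ->
  exists V : set (set T), [/\ open_cover V, refines V U & order_le V k].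

Definition finite_dimensional T := exists k, dim_le T k.

(* [F n] is coerced to the sigma type [set_type (F n)], which carries the
   subspace topology; empty [F n] are allowed, so finite unions are covered. *)
Definition countable_dimensional T := exists F : nat -> set T,
  \bigcup_n F n = setT /\ forall n, finite_dimensional (F n).

Definition partition_between T (A B L : set T) :=
  closed L /\ exists U W : set T,
    [/\ open U /\ open W, ~` L = U `|` W, U `&` W = set0, A `<=` U & B `<=` W].

Definition strongly_infinite_dimensional T := exists A B : nat -> set T,
  (forall i, [/\ closed (A i), closed (B i) & A i `&` B i = set0]) /\
  forall L : nat -> set T, (forall i, partition_between (A i) (B i) (L i)) ->
    \bigcap_i L i !=set0.

End Dimension.

(* [T] with the topology whose open sets are those containing, around each of
   their points, a [d]-ball of positive radius: the metric topology when [d] is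
   a metric. These sets form a topology for any [d], so the metric axioms are
   not needed to build it. *)
Definition dist_space (R : realType) (T : choiceType) (d : T -> T -> \bar R) :
  Type := T.

Section DistTopology.
Context {R : realType} {T : choiceType} (d : T -> T -> \bar R).

HB.instance Definition _ := Choice.on (dist_space d).

Definition dist_open : set (set (dist_space d)) := [set U |
  forall x, U x -> exists2 e : R, 0 < e & forall y, (d x y < e%:E)%E -> U y].

Let dist_openT : dist_open setT.
Proof. by move=> x _; exists 1. Qed.

Let dist_openI : setI_closed dist_open.
Proof.
move=> A B oA oB x [Ax Bx].
have [e e0 eA] := oA _ Ax; have [f f0 fB] := oB _ Bx.
exists (Num.min e f); first by rewrite lt_min e0.
move=> y xy; split; [apply: eA|apply: fB]; apply: lt_le_trans xy _;
  by rewrite lee_fin ge_min lexx ?orbT.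
Qed.

Let dist_open_bigU (I : Type) (f : I -> set (dist_space d)) :
  (forall i, dist_open (f i)) -> dist_open (\bigcup_i f i).
Proof.
move=> oF x [i _ fix_]; have [e e0 eF] := oF i _ fix_.
by exists e => // y /eF; exists i.
Qed.

HB.instance Definition _ :=
  isOpenTopological.Build (dist_space d) dist_openT dist_openI dist_open_bigU.

End DistTopology.

(* Metric spaces with a base point. The base point only records that the space
   is non-empty (and gives access to the library's sigma-algebras and complete
   spaces); isometries are not required to preserve it. *)
#[short(type="pmetricType")]
HB.structure Definition PointedMetric (K : numDomainType) :=
  {M of Metric K M & isPointed M}.

#[short(type="completeMetricType")]
HB.structure Definition CompleteMetric (K : numDomainType) :=
  {M of Metric K M & Complete M}.

Definition isometry (R : realType) (X Y : metricType R) (f : X -> Y) :=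
  {mono f : x y / mdist x y} /\ range f = setT.

(* The value [0] is adjoined only to get [dis set0 = 0]. *)
Definition dis (R : realType) (X Y : metricType R) (S : set (X * Y)) : \bar R :=
  ereal_sup (0%E |` [set `|mdist p.1 q.1 - mdist p.2 q.2|%:E
                     | p in S & q in S]).

Lemma isometry_id (R : realType) (X : metricType R) : isometry (@idfun X).
Proof. by split=> //; apply/seteqP; split=> // x _; exists x. Qed.

Lemma isometry_comp (R : realType) (X Y Z : metricType R) (f : X -> Y)
  (g : Y -> Z) : isometry f -> isometry g -> isometry (g \o f).
Proof.
move=> [fd fr] [gd gr]; split=> [x y|]; first by rewrite /= gd fd.
have -> : range (g \o f) = g @` range f by rewrite image_comp.
by rewrite fr.
Qed.

Lemma isometry_inv (R : realType) (X Y : metricType R) (f : X -> Y) :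
  isometry f -> exists g : Y -> X, [/\ isometry g, cancel f g & cancel g f].
Proof.
move=> [fd fr].
have /choice[g fg] : forall y, exists x, f x = y.
  by move=> y; have [x _ <-] : range f y by [rewrite fr]; exists x.
have gf : cancel f g by move=> x; apply/mdist_positivity; rewrite -fd fg mdistxx.
exists g; split=> //; split=> [x y|]; first by rewrite -fd !fg.
by apply/seteqP; split=> // x _; exists (f x).
Qed.

Section GromovHausdorff.
Variable R : realType.

(* The carrier and its structure are separate fields, not a single
   [pmetricType R], so that the carrier may live in a universe below the one of
   the library's structures and the quotient below can itself be a
   [topologicalType]. No isometry class is lost: a separable metric space has at
   most continuum many points, so it is isometric to a space whose carrier is a
   subtype of [nat -> bool]. The same holds for [mmSpace]. *)
Record compactMetricSpace := CompactMetricSpace {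
  cms_carrier : Type;
  cms_class : PointedMetric.axioms_ R cms_carrier;
  cms_compact : compact [set: PointedMetric.Pack cms_class] }.

Coercion cms_metric (X : compactMetricSpace) : pmetricType R :=
  PointedMetric.Pack (cms_class X).

HB.instance Definition _ := gen_eqMixin compactMetricSpace.
HB.instance Definition _ := gen_choiceMixin compactMetricSpace.

Definition correspondence (X Y : metricType R) (S : set (X * Y)) :=
  fst @` S = setT /\ snd @` S = setT.

Definition gh_dist (X Y : compactMetricSpace) : \bar R :=
  ((2^-1)%:E * ereal_inf [set dis S | S in @correspondence X Y])%E.

Definition isometric (X Y : compactMetricSpace) : bool :=
  `[< exists f : X -> Y, isometry f >].

Let isometric_refl : reflexive isometric.
Proof. by move=> X; apply/asboolP; exists idfun; exact: isometry_id. Qed.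

Let isometric_sym : symmetric isometric.
Proof.
by move=> X Y; apply: asbool_equiv_eq; split=> -[f /isometry_inv[g [ig _ _]]];
  exists g.
Qed.

Let isometric_trans : transitive isometric.
Proof.
move=> Y X Z /asboolP[f fi] /asboolP[g gi]; apply/asboolP.
by exists (g \o f); exact: isometry_comp.
Qed.

Canonical isometric_equiv :=
  EquivRel isometric isometric_refl isometric_sym isometric_trans.
Canonical isometric_enc := defaultEncModRel isometric.

(* [gh_dist] is invariant under isometries, so evaluating it at the chosen
   representatives is the distance between isometry classes. *)
Definition gh_class_dist (x y : {eq_quot isometric}) : \bar R :=
  gh_dist (repr x) (repr y).

Definition gh_space : topologicalType := dist_space gh_class_dist.

End GromovHausdorff.

Notation borel T := (g_sigma_algebraType (@open T)).

Section Box.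
Variable R : realType.
Local Open Scope ereal_scope.

Definition supp (T : ptopologicalType) (mu : {measure set (borel T) -> \bar R}) :
  set T := [set x | forall U, open U -> U x -> 0 < mu U].

Record mmSpace := MMSpace {
  mm_carrier : Type;
  mm_class : CompleteMetric.axioms_ R mm_carrier;
  mm_separable :
    exists2 D : set (CompleteMetric.Pack mm_class), countable D & dense D;
  mm_measure : probability (borel (CompleteMetric.Pack mm_class)) R;
  mm_supp : supp mm_measure = setT }.

Coercion mm_metric (X : mmSpace) : completeMetricType R :=
  CompleteMetric.Pack (mm_class X).

HB.instance Definition _ := gen_eqMixin mmSpace.
HB.instance Definition _ := gen_choiceMixin mmSpace.

(* [borel (X * Y)] is generated by the open sets of the product topology. *)
Definition coupling (X Y : mmSpace) :
    set {measure set (borel (X * Y)%type) -> \bar R} :=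
  [set pi | (forall A : set (borel X), measurable A ->
               pi (fst @^-1` A) = mm_measure X A) /\
            (forall B : set (borel Y), measurable B ->
               pi (snd @^-1` B) = mm_measure Y B)].

(* Both minima of the box distance are written as infima. *)
Definition box_dist (X Y : mmSpace) : \bar R :=
  ereal_inf [set ereal_inf [set maxe (1 - pi S) (dis S)
                           | S in [set S : set (X * Y) | closed S]]
            | pi in @coupling X Y].

Definition mm_isomorphism (X Y : mmSpace) (f : X -> Y) :=
  isometry f /\ forall B : set (borel Y), measurable B ->
    mm_measure Y B = pushforward (mm_measure X) (f : borel X -> borel Y) B.

Definition mm_isomorphic (X Y : mmSpace) : bool :=
  `[< exists f : X -> Y, mm_isomorphism f >].

Let mm_isomorphic_refl : reflexive mm_isomorphic.
Proof.
move=> X; apply/asboolP; exists idfun; split; first exact: isometry_id.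
by [].
Qed.

Let isometry_measurable (X Y : mmSpace) (f : X -> Y) : isometry f ->
  forall B : set (borel Y), measurable B ->
    measurable (f @^-1` B : set (borel X)).
Proof.
move=> [fd _] B mB; rewrite -[f @^-1` B]setTI.
apply: (@measurability _ _ (borel X) (borel Y) setT f open) => //.
move=> _ [U oU <-]; rewrite setTI; apply: sub_sigma_algebra.
apply: open_comp => // x _; apply/cvg_ballP => e e0.
apply: filterS (nbhsx_ballx x e e0) => t.
by rewrite !ballEmdist /= fd.
Qed.

Let mm_isomorphic_sym : symmetric mm_isomorphic.
Proof.
suff H X Y : mm_isomorphic X Y -> mm_isomorphic Y X.
  by move=> X Y; apply/idP/idP; exact: H.
move=> /asboolP[f [fi fmu]]; have [g [gi fg gf]] := isometry_inv fi.
apply/asboolP; exists g; split=> // A mA; rewrite /pushforward fmu; last first.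
  exact: isometry_measurable.
by rewrite /pushforward -comp_preimage (_ : g \o f = id)//; exact/funext.
Qed.

Let mm_isomorphic_trans : transitive mm_isomorphic.
Proof.
move=> Y X Z /asboolP[f [fi fmu]] /asboolP[g [gi gmu]]; apply/asboolP.
exists (g \o f); split; first exact: isometry_comp.
move=> C mC; rewrite gmu// /pushforward fmu//; exact: isometry_measurable.
Qed.

Canonical mm_isomorphic_equiv :=
  EquivRel mm_isomorphic mm_isomorphic_refl mm_isomorphic_sym
    mm_isomorphic_trans.
Canonical mm_isomorphic_enc := defaultEncModRel mm_isomorphic.

(* As for [gh_class_dist], the choice of representatives is immaterial. *)
Definition box_class_dist (x y : {eq_quot mm_isomorphic}) : \bar R :=
  box_dist (repr x) (repr y).

Definition box_space : topologicalType := dist_space box_class_dist.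

End Box.

(* Main.v *)
Require Import Defs.
From HB Require Import structures.
From mathcomp Require Import all_boot all_order all_fingroup all_algebra.
From mathcomp Require Import generic_quotient.
From mathcomp Require Import all_classical all_reals all_analysis.
From mathcomp Require Import zify lra.

Set Implicit Arguments.
Unset Strict Implicit.
Unset Printing Implicit Defensive.

Import Order.TTheory GRing.Theory Num.Theory.
Import numFieldNormedType.Exports.
Local Open Scope classical_set_scope.
Local Open Scope ring_scope.
Local Open Scope quotient_scope.

(** Both spaces receive a continuous map from the Hilbert cube [0,1]^nat that
    sends opposite faces to sets separated by open conditions. A sequence of legs
    of lengths 4^-n (1 + x_n) is glued at a point to a star-shaped metric on [nat]
    with d(m, n) = max(leg m, leg n), and, for the box distance, all stars carry
    the same measure. Whether x_i is 0 or 1 can be read off from the presence of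
    a distance close to 2 * 4^-i, up to an error controlled by the distance of
    the spaces, so no embedding is needed.

    That the cube has essential pairs of opposite faces is the Poincare-Miranda
    theorem. Its discrete form is proved on Kuhn's triangulation of a grid: modulo
    2, the sum over all simplices of the cup product of the coboundaries of
    functions a_0, ..., a_n separating opposite faces does not change when an a_i
    is replaced by another such function, by Stokes' formula.

    If the target were a union of F_0, F_1, ... with dim F_n <= k_n, reserve
    k_n + 1 pairs of faces for each n: an open cover of F_n of order k_n splits,
    as in a barycentric subdivision, into k_n + 1 disjoint families, and the j-th
    family yields an open partition of the j-th reserved pair, so that the
    k_n + 1 partitions have no common point over F_n. Since every point of the
    cube lies over some F_n, this contradicts Poincare-Miranda for all pairs. *)

(** * Cochains modulo 2 *)

Section Cochains.
Context {T : Type}.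
Implicit Types (A B : seq (T -> bool)) (w : nat -> T).

(* Cup product of the coboundaries of the functions in [A], with values in the
   two-element field [bool]. *)
Fixpoint cup A w : bool :=
  if A is f :: A' then (f (w 0) + f (w 1)) * cup A' (w \o S) else 1.

(* [b] is a 0-cochain, inserted between the coboundaries of [A] and [B]. *)
Fixpoint cupc A (b : T -> bool) B w : bool :=
  if A is f :: A' then (f (w 0) + f (w 1)) * cupc A' b B (w \o S)
  else b (w 0) * cup B w.

Lemma bumpS_compS w j : (w \o bump j.+1) \o S = (w \o S) \o bump j.
Proof. by apply/funext => k; rewrite /= /bump ltnS addnS. Qed.

Lemma bool_addrr (x : bool) : x + x = 0. Proof. by case: x. Qed.

Let face_sum (F : (nat -> T) -> bool) (f : T -> bool) (c : bool) n w :
  \sum_(j < n.+2) F (w \o S \o bump j) = c ->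
  \sum_(j < n.+3)
    (f ((w \o bump j) 0) + f ((w \o bump j) 1)) * F ((w \o bump j) \o S) =
  (f (w 0) + f (w 1)) * c.
Proof.
move=> <-; set s := \sum_(j < n.+1) F (w \o S \o bump j.+1).
have -> : \sum_(j < n.+2) F (w \o S \o bump j) = F (w \o S \o S) + s.
  by rewrite big_ord_recl; congr (_ + _); apply: eq_bigr => j _; rewrite lift0.
have -> : \sum_(j < n.+3)
    (f ((w \o bump j) 0) + f ((w \o bump j) 1)) * F ((w \o bump j) \o S) =
    (f (w 1) + f (w 2)) * F (w \o S \o S) +
    ((f (w 0) + f (w 2)) * F (w \o S \o S) + (f (w 0) + f (w 1)) * s).
  rewrite 2!big_ord_recl mulr_sumr; congr (_ + (_ + _)).
  by apply: eq_bigr => j _; rewrite !lift0 bumpS_compS.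
move: (F _) (f _) (f _) (f _) => a x y z.
by case: s a x y z => [] [] [] [] [].
Qed.

Lemma cup_closed A w : \sum_(j < (size A).+2) cup A (w \o bump j) = 0.
Proof.
elim: A w => [|f A IHA] w /=; first by rewrite !big_ord_recl big_ord0.
by rewrite (face_sum _ (IHA _)) mulr0.
Qed.

(** Leibniz rule: the factors in [A] and [B] are cocycles, so the coboundary falls on [b] alone. *)
Lemma cupc_stokes A b B w :
  \sum_(j < (size A + size B).+2) cupc A b B (w \o bump j) =
  cup (A ++ b :: B) w.
Proof.
elim: A w => [|f A IHA] w; last exact: (face_sum _ (IHA _)).
have -> : \sum_(j < (size B).+2) cupc [::] b B (w \o bump j) =
    b (w 1) * cup B (w \o S) +
    b (w 0) * \sum_(j < (size B).+1) cup B (w \o bump j.+1).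
  by rewrite big_ord_recl mulr_sumr.
have := cup_closed B w; rewrite big_ord_recl -[w \o bump 0]/(w \o S).
under eq_bigr => j _ do rewrite lift0.
rewrite /=; move: (\sum_(i < _) _) (cup _ _) (b _) (b _) => [] [] [] [] //=.
Qed.

Lemma cupD A f g B w :
  cup (A ++ (fun x => f x + g x) :: B) w =
  cup (A ++ f :: B) w + cup (A ++ g :: B) w.
Proof.
elim: A w => [|h A IHA] w /=; last by rewrite IHA mulrDr.
by rewrite -mulrDl addrACA.
Qed.

Lemma cup_const0 A f w i : (i < size A)%N ->
  (forall j, (j <= size A)%N -> nth f A i (w j) = nth f A i (w 0)) ->
  cup A w = 0.
Proof.
elim: A w i => [//|g A IHA] w [|i] /= iA fw.
  by rewrite fw// bool_addrr mul0r.
rewrite (IHA _ i) ?mulr0// => j jA /=.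
by rewrite fw// [RHS]fw.
Qed.

Lemma cupc_const0 A b B f w i : (i < size A + size B)%N ->
  (forall j, (j <= size A + size B)%N ->
    nth f (A ++ B) i (w j) = nth f (A ++ B) i (w 0)) ->
  cupc A b B w = 0.
Proof.
elim: A w i => [|g A IHA] w i /=.
  by move=> iB fw; rewrite (@cup_const0 B f _ i)// mulr0.
case: i => [|i] /= iA fw; first by rewrite fw// bool_addrr mul0r.
rewrite (IHA _ i) ?mulr0// => j jA /=.
by rewrite fw// [RHS]fw.
Qed.

Lemma cupc_zero A b B w :
  (forall j, (j <= size A + size B)%N -> b (w j) = 0) -> cupc A b B w = 0.
Proof.
elim: A w => [|g A IHA] w /= bw; first by rewrite bw ?mul0r.
by rewrite IHA ?mulr0// => j jA; exact: bw.
Qed.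

Lemma eq_cup A w w' : (forall j, (j <= size A)%N -> w j = w' j) ->
  cup A w = cup A w'.
Proof.
elim: A w w' => [//|g A IHA] w w' /= ww'; rewrite !ww'//.
by congr (_ * _); apply: IHA => j jA; exact: ww'.
Qed.

Lemma eq_cupc A b B w w' : (forall j, (j <= size A + size B)%N -> w j = w' j) ->
  cupc A b B w = cupc A b B w'.
Proof.
elim: A w w' => [|g A IHA] w w' /= ww'; rewrite ?ww'//.
  by congr (_ * _); exact: eq_cup.
by congr (_ * _); apply: IHA => j jA; exact: ww'.
Qed.

Lemma cup_mkseqP (a : nat -> T -> bool) n w :
  reflect (forall l, (l < n)%N -> a l (w l) <> a l (w l.+1))
    (cup (mkseq a n) w).
Proof.
suff H m : reflect
    (forall l, (l < n)%N -> a (m + l)%N (w l) <> a (m + l)%N (w l.+1))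
    (cup (map a (iota m n)) w) by exact: (H 0%N).
elim: n m w => [|n IHn] m w /=; first by apply: (iffP idP).
apply: (iffP andP) => [[aw /IHn ih] [|l]|h].
- by rewrite addn0 => _; move: aw; do 2!case: (a _ _).
- by rewrite addnS -addSn ltnS => /ih.
split; last by apply/IHn => l ln; rewrite addSn -addnS; apply: h.
by have := h 0%N isT; rewrite addn0; do 2!case: (a _ _).
Qed.

End Cochains.

Arguments cup : simpl never.

(** * Kuhn's triangulation and the discrete Poincare-Miranda theorem *)

Section Kuhn.
Context {n m : nat}.
Local Notation point := ('I_n.+1 -> nat).
Implicit Types (x : {ffun 'I_n.+1 -> 'I_m.+1}) (p : 'S_n.+1).

(* The vertices [kuhn x p 0, ..., kuhn x p n.+1] of the simplices of Kuhn's
   triangulation of the cube [0, m.+1]^n.+1: start at [x] and increase the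
   coordinates one after the other, in the order given by [p]. *)
Definition kuhn x p j : point := fun k => (x k + (p k < j))%N.

Section Boundary.
Variable c : (nat -> point) -> bool.
Hypothesis c_ext : forall w w', (forall j, (j <= n)%N -> w j = w' j) ->
  c w = c w'.
Hypothesis c_face0 : forall w k,
  (forall j, (j <= n)%N -> w j k = 0%N) -> c w = 0.
Hypothesis c_face1 : forall w k,
  (forall j, (j <= n)%N -> w j k = m.+1) -> c w = 0.

(** Exchanging the two consecutive moves around vertex [j] changes no other vertex, so each inner
    face belongs to two simplices of the same small cube. *)
Let inner_face x j : (0 < j <= n)%N -> \sum_p c (kuhn x p \o bump j) = 0.
Proof.
move=> /andP[j0 jn].
pose t : 'S_n.+1 := tperm (inord j.-1) (inord j).
have vj : (inord j : 'I_n.+1) = j :> nat by rewrite inordK.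
have vj1 : (inord j.-1 : 'I_n.+1) = j.-1 :> nat by rewrite inordK; lia.
have dt : inord j.-1 != inord j :> 'I_n.+1 by rewrite -val_eqE /= vj vj1; lia.
have ct p : c (kuhn x (p * t)%g \o bump j) = c (kuhn x p \o bump j).
  congr (c _); apply/funext => i; apply/funext => k /=; congr (_ + _)%N.
  rewrite permM /t; case: tpermP => [->|->|//]; rewrite ?vj ?vj1 /bump;
    by case: leqP; lia.
(* Multiplication by [t] exchanges even and odd permutations, so the two halves of the sum are equal
   and cancel. *)
rewrite (bigID (fun p => odd_perm p)) /= [X in X + _](reindex_inj (mulIg t)) /=.
rewrite [X in X + _](eq_big (fun p => ~~ odd_perm p)
  (fun p => c (kuhn x p \o bump j))).
- exact: bool_addrr.
- by move=> p; rewrite odd_permM odd_tperm dt addbT.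
- by move=> p _; exact: ct.
Qed.

Let rot : 'S_n.+1 := perm (@ord_pred_inj n.+1).

(** Moves to the neighbouring cube in the first direction of [p]; the cyclic successor makes this a
    bijection even at the boundary. *)
Let shift p x : {ffun 'I_n.+1 -> 'I_m.+1} :=
  [ffun k => if p k == 0 then ordS (x k) else x k].

Let shift_inj p : injective (shift p).
Proof.
move=> x y /ffunP xy; apply/ffunP => k; have := xy k; rewrite !ffunE.
by case: ifP => // _ /ordS_inj.
Qed.

(** Without its first vertex, a simplex is the neighbouring simplex without its last one, whose
    moves are rotated. If [shift] wraps around, the two faces lie in opposite sides of the big cube,
    where [c] vanishes. *)
Let outer_face x p :
  c (kuhn x p \o bump 0) = c (kuhn (shift p x) (p * rot)%g \o bump n.+1).
Proof.
pose k0 := (p^-1%g 0); have pk0 : p k0 = 0 by rewrite permKV.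
have bj j : (j <= n)%N -> bump n.+1 j = j by rewrite /bump; case: leqP; lia.
have [xk0|xk0] := eqVneq (val (x k0)) m.
  rewrite (c_face1 (k := k0)) => [|j jn]; last first.
    by rewrite /= /kuhn pk0 /bump /= xk0 addn1.
  rewrite (c_face0 (k := k0)) => // j jn.
  rewrite /= /kuhn /shift !ffunE permM permE pk0 eqxx /= xk0 modnn bj//.
  by rewrite add0n modn_small// ltnNge jn.
apply: c_ext => j jn; apply/funext => k /=.
rewrite /kuhn /shift !ffunE permM permE bj//= /bump /= add1n ltnS.
have [pk|pk] := eqVneq (p k) 0.
  have xk : (x k < m)%N.
    have -> : k = k0 by apply: (@perm_inj _ p); rewrite pk0.
    by rewrite ltn_neqAle xk0 -ltnS ltn_ord.
  by rewrite pk /= modn_small// modn_small ?ltnS//; lia.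
have pk0n : (0 < p k)%N by rewrite lt0n.
rewrite (_ : (p k + n.+1).-1 = (p k).-1 + n.+1)%N; last by lia.
rewrite modnDr modn_small; last by have := ltn_ord (p k); lia.
by congr (_ + (nat_of_bool _))%N; lia.
Qed.

(** Inner faces cancel within each small cube, first and last faces between neighbouring cubes. *)
Lemma boundary_sum0 :
  \sum_x \sum_p \sum_(j < n.+2) c (kuhn x p \o bump j) = 0.
Proof.
under eq_bigr => x _ do rewrite exchange_big /=.
rewrite exchange_big /= big_ord_recl big_ord_recr /=.
rewrite [X in _ + (X + _)]big1 ?add0r => [|j _]; last first.
  by apply: big1 => x _; rewrite inner_face//= lift0.
rewrite (_ : \sum_x \sum_p c (kuhn x p \o bump 0) =
  \sum_x \sum_p c (kuhn x p \o bump n.+1)); first exact: bool_addrr.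
rewrite exchange_big [RHS]exchange_big [RHS](reindex_inj (mulIg rot)) /=.
apply: eq_bigr => p _; rewrite [RHS](reindex_inj (@shift_inj p)) /=.
by apply: eq_bigr => x _; rewrite outer_face.
Qed.

End Boundary.

Definition coordinate (l : nat) : point -> bool := fun y => (0 < y (inord l))%N.

(** Only the simplex at the origin with the identity order contributes: the [l]-th coordinate must
    become positive exactly at the [l]-th move. *)
Lemma sum_coordinate :
  \sum_x \sum_p cup (mkseq coordinate n.+1) (kuhn x p) = 1.
Proof.
rewrite (bigD1 [ffun=> 0])//= (bigD1 1%g)//= [X in X + _]addrC.
rewrite (_ : cup _ _ = 1); last first.
  rewrite -[_ = 1]/(is_true _).
  apply/cup_mkseqP => l ln; rewrite /coordinate /kuhn ffunE perm1 inordK//.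
  by rewrite ltnn leqnn.
have E x p : cup (mkseq coordinate n.+1) (kuhn x p) -> x = [ffun=> 0] /\ p = 1%g.
  move=> /cup_mkseqP h.
  have {}h (k : 'I_n.+1) : x k = 0 /\ p k = k.
    have := h k (ltn_ord k); rewrite /coordinate /kuhn inord_val => hk.
    have xk : x k = 0%N :> nat by lia.
    by split; apply: val_inj => //=; lia.
  by split; [apply/ffunP => k; rewrite ffunE|apply/permP => k; rewrite perm1];
    have [] := h k.
rewrite [X in (X + _) + _]big1 ?add0r => [|p]; last first.
  by move=> p1; apply/negbTE/negP => /E[_] /eqP; rewrite (negbTE p1).
rewrite big1 ?addr0// => x x0; apply: big1 => p _.
by apply/negbTE/negP => /E[/eqP]; rewrite (negbTE x0).
Qed.

(** The number of such simplices is odd: it is so for the coordinate functions, and its parity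
    survives replacing them by the [a k] one at a time. *)
Lemma kuhn_transverse (a : 'I_n.+1 -> point -> bool) :
  (forall k y, y k = 0%N -> a k y = false) ->
  (forall k y, y k = m.+1 -> a k y = true) ->
  exists x p, forall k : 'I_n.+1, a k (kuhn x p k) <> a k (kuhn x p k.+1).
Proof.
move=> a0 a1.
pose h i l : point -> bool :=
  if (l < i)%N then coordinate l else a (inord l).
have h0 i l y : (l <= n)%N -> y (inord l) = 0%N -> h i l y = 0.
  by rewrite /h /coordinate => ln y0; case: ifP => _; rewrite ?y0// a0.
have h1 i l y : (l <= n)%N -> y (inord l) = m.+1 -> h i l y = 1.
  by rewrite /h /coordinate => ln y0; case: ifP => _; rewrite ?y0// a1.
suff S1 i : (i <= n.+1)%N -> \sum_x \sum_p cup (mkseq (h i) n.+1) (kuhn x p) = 1.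
  have : exists x p, cup (mkseq (h 0%N) n.+1) (kuhn x p).
    apply: contrapT => nex; have := S1 0%N isT; rewrite big1// => x _.
    by rewrite big1// => p _; apply/negbTE/negP => xp; apply: nex; exists x, p.
  move=> [x [p /cup_mkseqP xp]]; exists x, p => k.
  by have := xp k (ltn_ord k); rewrite /h /= inord_val.
(* Descending induction from [n.+1], where all functions are coordinates, to 0, where all are given
   ones. *)
move=> iN; rewrite -(subKn iN); move: (n.+1 - i)%N => {iN}i.
elim: i => [|i IHi].
  rewrite subn0 -[RHS]sum_coordinate; apply: eq_bigr => x _; apply: eq_bigr => p _.
  congr (cup _ _); apply/eq_in_map => l; rewrite mem_iota add0n => /andP[_ ln].
  by rewrite /h ln.
have [iN|] := leqP n.+1 i.
  by rewrite (_ : (n.+1 - i.+1 = n.+1 - i)%N)//; lia.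
move=> iN; set q := (n.+1 - i.+1)%N in IHi *.
have Eq : (n.+1 - i = q.+1)%N by rewrite /q; lia.
have qn : (q <= n)%N by rewrite /q; lia.
rewrite Eq in IHi.
have split_h r : mkseq (h r) n.+1 = map (h r) (iota 0 q) ++ h r q ::
    map (h r) (iota q.+1 (n - q)).
  rewrite /mkseq -map_cons -map_cat; congr map.
  by rewrite -[q :: _]/(iota q (n - q).+1) -iotaD addnS subnKC.

pose A := map coordinate (iota 0 q).
pose B := map (fun l => a (inord l)) (iota q.+1 (n - q)).
have sAB : (size A + size B = n)%N by rewrite !size_map !size_iota subnKC.
have hA r : (q <= r)%N -> map (h r) (iota 0 q) = A.
  move=> qr; apply/eq_in_map => l; rewrite mem_iota add0n => /andP[_ lq].
  by rewrite /h (leq_trans lq qr).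
have hB r : (r <= q.+1)%N -> map (h r) (iota q.+1 (n - q)) = B.
  move=> rq; apply/eq_in_map => l; rewrite mem_iota => /andP[ql _].
  by rewrite /h ltnNge (leq_trans rq ql).
have hAB l y : (l < n)%N -> nth xpredT (A ++ B) l y =
    h q.+1 (if (l < q)%N then l else l.+1) y.
  move=> ln; rewrite nth_cat size_map size_iota; case: ifPn => lq.
    by rewrite (nth_map 0%N) ?size_iota// nth_iota// /h ltnS ltnW.
  rewrite -leqNgt in lq; rewrite (nth_map 0%N) ?size_iota ?ltn_sub2r//; last first.
    by lia.
  rewrite nth_iota; last by lia.
  by rewrite addSn subnKC// /h ltnS ltnNge lq.
(* The replaced and the replacing function agree on both sides in direction [q], so [b] vanishes
   there. *)
pose b y := h q q y + h q.+1 q y.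
have face w (k : 'I_n.+1) (v : bool) :
    (forall r j, (j <= n)%N -> h r k (w j) = v) -> cupc A b B w = 0.
  move=> wk; have [kq|kq] := eqVneq (k : nat) q.
    apply: cupc_zero => j; rewrite sAB => jn.
    by rewrite /b -kq !wk// bool_addrr.
  (* Position of direction [k] in [A ++ B], where [q] is left out. *)
  pose l := (if (k < q)%N then k : nat else k.-1).
  have ln : (l < n)%N by rewrite /l; have := ltn_ord k; case: ifP; lia.
  apply: (@cupc_const0 _ _ _ _ xpredT _ l) => [|j]; rewrite sAB// => jn.
  rewrite !hAB//; have -> : (if (l < q)%N then l else l.+1) = k.
    by rewrite /l; case: (ltnP k q) => [->//|?]; rewrite ifN ?prednK//; lia.
  by rewrite !wk.
rewrite -IHi; apply/eqP; rewrite -subr_eq0; apply/eqP.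
(* By [cupc_stokes] the two sums differ by the sum of [cupc A b B] over all faces of all
   simplices. *)
rewrite -sumrB -[RHS](@boundary_sum0 (cupc A b B)).
- apply: eq_bigr => x _; rewrite -sumrB; apply: eq_bigr => p _.
  have := cupc_stokes A b B (kuhn x p); rewrite sAB => ->.
  by rewrite cupD !split_h !hA ?hB//; do 2!case: (cup _ _).
- by move=> w w' ww'; apply: eq_cupc; rewrite sAB.
- move=> w k wk; apply: (face _ k false) => r j jn.
  by apply: h0; [rewrite -ltnS|rewrite inord_val wk].
- move=> w k wk; apply: (face _ k true) => r j jn.
  by apply: h1; [rewrite -ltnS|rewrite inord_val wk].
Qed.

End Kuhn.

(** * The Hilbert cube *)

Section Cube.
Context {R : realType}.
Implicit Types (x y z u v : nat -> R) (r : R).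

Definition cube : set (nat -> R) := [set x | forall i, 0 <= x i <= 1].

(* The balls of the metric sup_i |x i - y i| / (i + 1). *)
Definition cube_ball r x : set (nat -> R) :=
  [set y | cube y /\ forall i, `|x i - y i| <= r * i.+1%:R].

Lemma cube_ballxx r x : cube x -> 0 <= r -> cube_ball r x x.
Proof. by move=> cx r0; split=> // i; rewrite subrr normr0 mulr_ge0. Qed.

Lemma cube_ball_sym r x y : cube x -> cube_ball r x y -> cube_ball r y x.
Proof. by move=> cx [cy xy]; split=> // i; rewrite distrC. Qed.

Lemma cube_ball_trans r s x y z :
  cube_ball r x y -> cube_ball s y z -> cube_ball (r + s) x z.
Proof.
move=> [cy xy] [cz yz]; split=> // i; rewrite mulrDl.
by rewrite (le_trans (ler_distD (y i) _ _))// lerD.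
Qed.

Lemma cube_ball_le r s x : r <= s -> cube_ball r x `<=` cube_ball s x.
Proof.
by move=> rs y [cy xy]; split=> // i; rewrite (le_trans (xy i))// ler_wpM2r.
Qed.

(** Tychonoff's theorem for the product topology, in terms of [cube_ball]. *)
Lemma cube_cluster (z : nat -> nat -> R) : (forall n, cube (z n)) ->
  exists2 y, cube y &
    forall r N, 0 < r -> exists2 n, (N <= n)%N & cube_ball r y (z n).
Proof.
move=> cz.
pose T := prod_topology (fun _ : nat => (R : topologicalType)).
pose K : set T := [set f | forall i, `[0, 1]%classic (f i)].
have cK : compact K.
  apply: (@tychonoff nat (fun=> (R : topologicalType))
    (fun=> `[0, 1]%classic)) => i.
  exact: segment_compact.
have FK : (z @ \oo) K.
  by exists 0%N => // n _ i; rewrite /= in_itv /=; exact: cz.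
have [y [Ky clusty]] := cK _ (fmap_proper_filter _ _) FK.
have cy : cube y by move=> i; have := Ky i; rewrite /= in_itv.
exists y => // r N r0.
(* From coordinate [M] on, the radius [r * i.+1] is at least 1 and the condition is void. *)
have [M rM] : exists M : nat, 1 <= r * M.+1%:R.
  exists (Num.bound r^-1); rewrite mulrC -ler_pdivrMr// mul1r.
  have rb : r^-1 < (Num.bound r^-1)%:R by rewrite archi_boundP// invr_ge0 ltW.
  by rewrite (le_trans (ltW rb))// ler_nat.
have ny (k : nat) : nbhs y [set f | forall i, (i < k)%N -> `|y i - f i| < r].
  elim: k => [|k IHk]; first exact: filterS filterT.
  have /(_ [set t | `|y k - t| < r]) pk :=
    @proj_continuous _ (fun _ : nat => (R : topologicalType)) k y.
  apply: filterS (filterI IHk (pk _)).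
    move=> f [fi fk] i; rewrite ltnS leq_eqVlt => /predU1P[->|/fi//].
    exact: fk.
  exact: (nbhsx_ballx (y k) r r0).
have [] := clusty [set z n | n in [set n | (N <= n)%N]] _ _ (ny M).
  by exists N => // n /= Nn; exists n.
move=> _ [[n /= Nn <-] zn]; exists n => //; split; first exact: cz.
move=> i; have [iM|Mi] := ltnP i M.
  rewrite (le_trans (ltW (zn i iM)))// ler_peMr ?ler1n//.
  exact: ltW.
rewrite (@le_trans _ _ 1)//.
  by have := cy i; have := cz n i; rewrite ler_norml; lra.
by rewrite (le_trans rM)// ler_pM2l// ler_nat ltnS.
Qed.

(** Poincare-Miranda for arbitrary sets [U i]: grids of mesh [1 / n.+1] in the first [n.+1]
    coordinates give approximate solutions, and these have a cluster point. *)
Lemma cube_transverse (U : nat -> set (nat -> R)) :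
  (forall i x, cube x -> x i = 0 -> U i x) ->
  (forall i x, cube x -> x i = 1 -> ~ U i x) ->
  exists2 y, cube y & forall i r, 0 < r ->
    cube_ball r y `&` U i !=set0 /\ cube_ball r y `&` ~` U i !=set0.
Proof.
move=> U0 U1.
have fin n : exists2 z, cube z & forall i r, (i <= n)%N -> n.+1%:R^-1 <= r ->
    cube_ball r z `&` U i !=set0 /\ cube_ball r z `&` ~` U i !=set0.
  pose q (y : 'I_n.+1 -> nat) k : R :=
    if (k <= n)%N then (y (inord k))%:R / n.+1%:R else 0.
  have N0 : 0 < n.+1%:R :> R by rewrite ltr0n.
  have Ni : 0 <= n.+1%:R^-1 :> R by rewrite invr_ge0 ltW.
  have cq (w : 'I_n.+1 -> nat) : (forall k, (w k <= n.+1)%N) -> cube (q w).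
    move=> yn k; rewrite /q; case: ifP => _; last by rewrite lexx ler01.
    by rewrite divr_ge0//= ler_pdivrMr// mul1r ler_nat.
  (* Tells whether the grid point lies outside [U k]; the other clauses force the boundary values
     also at points outside the grid. *)
  pose a (k : 'I_n.+1) (w : 'I_n.+1 -> nat) :=
    (w k != 0%N) && ((w k == n.+1) || ~~ `[< U k (q w) >]).
  have [k y yk|k y yk|x [p xp]] := @kuhn_transverse n n a.
  - by rewrite /a yk.
  - by rewrite /a yk eqxx.
  have cv j : cube (q (kuhn x p j)).
    apply: cq => k; rewrite /kuhn (@leq_trans (x k + 1))//.
      by rewrite leq_add2l leq_b1.
    by rewrite addn1 ltn_ord.
  have aE j (k : 'I_n.+1) : a k (kuhn x p j) = ~~ `[< U k (q (kuhn x p j)) >].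
    have qk : q (kuhn x p j) k = (kuhn x p j k)%:R / n.+1%:R.
      by rewrite /q -ltnS ltn_ord inord_val.
    rewrite /a; have [kj|kj] /= := eqVneq (kuhn x p j k) 0%N.
      by apply/esym/negbTE/negPn/asboolP/U0 => //; rewrite qk kj mul0r.
    have [kj1|//] := eqVneq (kuhn x p j k) n.+1.
    by apply/esym/asboolPn/U1 => //; rewrite qk kj1 divff ?gt_eqF.
  exists (q (kuhn x p 0%N)) => // i r iN nr.
  have bq j : cube_ball r (q (kuhn x p 0%N)) (q (kuhn x p j)).
    split=> // k; rewrite (@le_trans _ _ r)//; last first.
      by rewrite ler_peMr ?ler1n// (le_trans _ nr)// invr_ge0 ltW.
    rewrite (le_trans _ nr)// /q; case: ifP => _; last first.
      by rewrite subrr normr0 invr_ge0 ltW.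
    rewrite -mulrBl normrM [`|_^-1|]ger0_norm// ler_piMl//.
    rewrite /kuhn ltn0 addn0 natrD opprD addrA subrr add0r normrN.
    by rewrite ger0_norm// lern1 leq_b1.
  have := xp (Ordinal (n:=n.+1) (m:=i) iN); rewrite !aE /=.
  case: asboolP => u; case: asboolP => v // _; split.
  - by exists (q (kuhn x p i)).
  - by exists (q (kuhn x p i.+1)).
  - by exists (q (kuhn x p i.+1)).
  - by exists (q (kuhn x p i)).
have /choice[z zP] : forall n, exists z, cube z /\ forall i r, (i <= n)%N ->
    n.+1%:R^-1 <= r ->
    cube_ball r z `&` U i !=set0 /\ cube_ball r z `&` ~` U i !=set0.
  by move=> n; have [z cz zP] := fin n; exists z.
have [y cy yP] := cube_cluster (fun n => (zP n).1).
exists y => // i r r0.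
have r20 : 0 < r / 2 by rewrite divr_gt0.
have [n] := yP _ (maxn i (Num.bound (r / 2)^-1)) r20.
rewrite geq_max => /andP[ni nr] yz.
have [|[u [zu Uu]] [v [zv Uv]]] := (zP n).2 i (r / 2) ni.
  have rb : (r / 2)^-1 < (Num.bound (r / 2)^-1)%:R.
    by rewrite archi_boundP// invr_ge0 ltW.
  by rewrite invf_ple ?posrE// (le_trans (ltW rb))// ler_nat (leq_trans nr).
by split; [exists u|exists v]; split=> //; rewrite [r]splitr;
  exact: cube_ball_trans yz _.
Qed.

End Cube.

(** * Transfer of infinite-dimensionality from the cube *)

Section Dimension.
Context {T : topologicalType} {F : set T} {k : nat}.

(** Members of a refinement are grouped by a chosen [W i] containing them, which cannot raise the
    order. They are extended to open sets of [T], hence the inclusion in [W i] only over [F]. *)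
Lemma dim_le_cover (I : finType) (W : I -> set T) : dim_le F k ->
  (forall i, open (W i)) -> F `<=` \bigcup_i W i ->
  exists V : I -> set T, [/\ forall i, open (V i), F `<=` \bigcup_i V i,
    forall i, F `&` V i `<=` W i &
    forall t, F t -> (#|[set i | `[< V i t >]]%SET| <= k.+1)%N].
Proof.
move=> dimF oW FW.
pose U : set (set F) := [set set_val @^-1` W i | i in [set: I]].
have [|V [[oV coverV] refV ordV]] := dimF U.
  split; first by move=> _ [i _ <-]; exists (W i).
  apply/seteqP; split=> // p _; have [i _ Wi] := FW _ (set_valP p).
  by exists (set_val @^-1` W i) => //; exists i.
have /choice[Q QP] : forall B : set F, exists Q : set T,
    V B -> open Q /\ set_val @^-1` Q = B.
  move=> B; have [VB|nVB] := pselect (V B); last by exists set0.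
  by have [Q oQ QB] := oV B VB; exists Q.
have [i0 _|I0] := pickP (@predT I); last first.
  exists (fun=> set0); split=> [_|t Ft|i t [_ []]|t Ft]; first exact: open0.
    by have [i] := FW t Ft; have := I0 i.
  by have [i] := FW t Ft; have := I0 i.
have /choice[s sP] : forall B : set F, exists i, V B -> B `<=` set_val @^-1` W i.
  move=> B; have [VB|nVB] := pselect (V B); last by exists i0.
  by have [_ [i _ <-] Bi] := refV B VB; exists i.
pose V' i := \bigcup_(B in [set B | V B /\ s B = i]) Q B.
have V'E (p : F) i : V' i (set_val p) -> exists B, [/\ V B, B p & s B = i].
  move=> [B [VB sB] QB]; exists B; split=> //.
  by rewrite -(QP B VB).2.
exists V'; split.
- by move=> i; apply: bigcup_open => B [/QP[]].
- move=> t Ft; pose p : F := SigSub (mem_set Ft).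
  have [B VB Bp] : (\bigcup_(A in V) A) p by rewrite coverV.
  exists (s B) => //; exists B => //.
  by rewrite -(QP B VB).2 in Bp.
- move=> i t [Ft]; pose p : F := SigSub (mem_set Ft).
  rewrite -[t]/(set_val p) => /V'E[B [VB Bp <-]].
  exact: (sP B VB).
move=> t Ft; pose p : F := SigSub (mem_set Ft).
(* Distinct indices at [t] come from distinct members of the refinement. *)
have /choice[g gP] : forall i, exists B, V' i t -> [/\ V B, B p & s B = i].
  move=> i; have [Vi|nVi] := pselect (V' i t); last by exists set0.
  by have [B BP] := @V'E p i Vi; exists B.
have /pcard_leP[f] := ordV p.
rewrite -[X in (_ <= X)%N]card_ord.
rewrite -(@card_in_imset _ _ (fun i => inord (f (g i)) : 'I_k.+1)).
  exact: max_card.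
move=> i j; rewrite !inE => /gP[Vi gi si] /gP[Vj gj sj] fij.
rewrite -si -sj; congr s.
have fK B : V B -> B p -> (f B < k.+1)%N.
  by move=> VB Bp; apply: (@funS _ _ _ _ f B).
apply: (@inj _ _ _ f); rewrite ?inE//.
by have := congr1 (@nat_of_ord _) fij; rewrite !inordK ?fK.
Qed.

End Dimension.

Section Transfer.
Context {R : realType} {T : topologicalType}.
Variables (Phi : (nat -> R) -> T) (G H : nat -> set T).
Hypothesis Phi_continuous : forall x V, cube x -> open V -> V (Phi x) ->
  exists2 r, 0 < r & cube_ball r x `<=` Phi @^-1` V.
Hypothesis openG : forall i, open (G i).
Hypothesis openH : forall i, open (H i).
Hypothesis GH : forall i t, G i t \/ H i t.
Hypothesis face0 : forall i x, cube x -> x i = 0 -> ~ H i (Phi x).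
Hypothesis face1 : forall i x, cube x -> x i = 1 -> ~ G i (Phi x).

(** The pairs are the complements of [H i] and [G i]. A transverse point for the preimages of one
    side of each partition is mapped into every [L i], since both sides are open. *)
Lemma strongly_infinite_dimensional_transfer : strongly_infinite_dimensional T.
Proof.
exists (fun i => ~` H i), (fun i => ~` G i); split=> [i|L LP].
  split; [exact: open_closedC|exact: open_closedC|].
  by apply/seteqP; split=> // t [Ht Gt]; case: (GH i t).
have /choice[U /choice[W UW]] : forall i, exists U W : set T,
    [/\ open U /\ open W, ~` L i = U `|` W, U `&` W = set0,
    ~` H i `<=` U & ~` G i `<=` W] by move=> i; have [] := LP i.
have [i x cx xi|i x cx xi|y cy yU] := @cube_transverse R (fun i => Phi @^-1` U i).
- by have [_ _ _ HU _] := UW i; apply/HU/face0.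
- have [_ _ UW0 _ GW] := UW i => Ux.
  by have : (U i `&` W i) (Phi x) by [split=> //; apply/GW/face1]; rewrite UW0.
exists (Phi y) => i _; apply: contrapT => nL.
have [[oU oW] LUW UW0 _ _] := UW i.
have : (U i `|` W i) (Phi y) by rewrite -LUW.
case=> [Uy|Wy].
  have [r r0 rU] := Phi_continuous cy oU Uy.
  by have [_ [u [/rU]]] := yU i r r0.
have [r r0 rW] := Phi_continuous cy oW Wy.
have [[u [/rW Wu Uu]] _] := yU i r r0.
by have : (U i `&` W i) (Phi u) by []; rewrite UW0.
Qed.

Definition cube_open (A : set (nat -> R)) :=
  forall x, cube x -> A x -> exists2 r, 0 < r & cube_ball r x `<=` A.

Lemma cube_open_preimage V : open V -> cube_open (Phi @^-1` V).
Proof. by move=> oV x cx; exact: Phi_continuous. Qed.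

Lemma cube_openI A B : cube_open A -> cube_open B -> cube_open (A `&` B).
Proof.
move=> oA oB x cx [/(oA _ cx)[r r0 rA] /(oB _ cx)[s s0 sB]].
exists (Num.min r s); first by rewrite lt_min r0.
by move=> y xy; split; [apply: rA|apply: sB]; apply: cube_ball_le xy;
  rewrite ge_min lexx ?orbT.
Qed.

Lemma cube_open_bigcup (I : Type) (D : set I) (A : I -> set (nat -> R)) :
  (forall i, D i -> cube_open (A i)) -> cube_open (\bigcup_(i in D) A i).
Proof.
move=> oA x cx [i Di /(oA i Di _ cx)[r r0 rA]].
by exists r => // y /rA; exists i.
Qed.

Section Separation.
Context {F : set T} {k : nat} {I : finType} {V : I -> set T}.
Hypothesis openV : forall i, open (V i).

(* The open piece of the cube on which the largest of the numbers
   [sup {r | the r-ball around x meets Phi^-1 F inside Phi^-1 (V i)}] are those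
   with index [i \in J]. *)
Definition level_set (J : {set I}) : set (nat -> R) := [set x |
  exists r0 r1, [/\ r0 < r1,
    forall i y, i \in J -> cube_ball r1 x y -> F (Phi y) -> V i (Phi y) &
    forall i, i \notin J -> exists y,
      [/\ cube_ball r0 x y, F (Phi y) & ~ V i (Phi y)]]].

Lemma cube_open_level_set J : cube_open (level_set J).
Proof.
move=> x cx [r0 [r1 [r01 inJ outJ]]].
(* Moving the centre by a third of the gap costs a third at either end. *)
exists ((r1 - r0) / 3); first by rewrite divr_gt0// subr_gt0.
move=> z xz; have zx := cube_ball_sym cx xz.
exists (r0 + (r1 - r0) / 3), (r1 - (r1 - r0) / 3); split; first by lra.
- move=> i y iJ zy; apply: inJ iJ _.
  by have := cube_ball_trans xz zy; rewrite addrC subrK.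
- move=> i /outJ[y [xy Fy nVy]]; exists y; split=> //.
  by rewrite addrC; exact: cube_ball_trans zx xy.
Qed.

(** Both sets are upper segments in the order of the indices by radius, hence comparable. *)
Lemma level_set_inj J J' x : level_set J x -> level_set J' x ->
  #|J| = #|J'| -> J = J'.
Proof.
move=> [r0 [r1 [r01 inJ outJ]]] [s0 [s1 [s01 inJ' outJ']]] JJ'.
have sub : (J \subset J') || (J' \subset J).
  apply/negPn/negP; rewrite negb_or => /andP[/subsetPn[i iJ iJ']].
  move=> /subsetPn[j jJ' jJ].
  have [y [xy Fy nVy]] := outJ' i iJ'.
  have [z [xz Fz nVz]] := outJ j jJ.
  have rs : r1 < s0.
    rewrite ltNge; apply/negP => sr; apply: nVy.
    exact: (inJ i y iJ (cube_ball_le sr xy)).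
  have sr : s1 < r0.
    rewrite ltNge; apply/negP => rs'; apply: nVz.
    exact: (inJ' j z jJ' (cube_ball_le rs' xz)).
  by have := lt_trans (lt_trans r01 rs) (lt_trans s01 sr); rewrite ltxx.
by case/orP: sub => sub; apply/eqP; [|rewrite eq_sym];
  rewrite eqEcard sub JJ' leqnn.
Qed.

(** By continuity the indices in the set have positive radius; for the others [x] is a witness at
    radius 0. *)
Lemma level_set_self x : cube x -> F (Phi x) ->
  level_set [set i | `[< V i (Phi x) >]]%SET x.
Proof.
move=> cx Fx; set J := [set _ | _]%SET.
have /choice[r rP] : forall i, exists r : R,
    0 < r /\ (i \in J -> cube_ball r x `<=` Phi @^-1` V i).
  move=> i; have [iJ|iJ] := boolP (i \in J); last by exists 1; rewrite ltr01.
  have Vi : V i (Phi x) by move: iJ; rewrite inE => /asboolP.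
  by have [s s0 sV] := Phi_continuous cx (openV i) Vi; exists s.
exists 0, (\big[Num.min/1]_i r i); split.
- by apply: lt_bigmin => // i _; exact: (rP i).1.
- move=> i y iJ xy _; apply: (rP i).2 => //; apply: cube_ball_le xy.
  exact: bigmin_le.
- move=> i; rewrite inE => /asboolPn nV; exists x; split=> //.
  exact: cube_ballxx.
Qed.

End Separation.

(* The pieces [level_set J] with [#|J| = j.+1] are disjoint; for each of them, a
   chosen set [S \in J] of indices tells whether to put it on the side of [G] or
   of [H] in the pair of index [b j]. *)
Lemma dim_le_separation (F : set T) k (b : nat -> nat) : dim_le F k ->
  exists P N : nat -> set (nat -> R), [/\
    forall j, cube_open (P j) /\ cube_open (N j),
    forall j, P j `&` N j = set0,
    forall j, P j `<=` Phi @^-1` G (b j) /\ N j `<=` Phi @^-1` H (b j) &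
    forall x, cube x -> F (Phi x) -> exists j, P j x \/ N j x].
Proof.
move=> dimF; pose I := {set 'I_k.+1}.
(* [S] is a sign pattern: it selects [G] or [H] for each of the [k.+1] reserved pairs. *)
pose W (S : I) : set T := [set t | forall j : 'I_k.+1,
  if j \in S then G (b j) t else H (b j) t].
have oW S : open (W S).
  rewrite openE => t Wt; apply: (@filter_forall T 'I_k.+1) => j.
  by have := Wt j; case: ifP => _ ?; apply: open_nbhs_nbhs; split.
have [|V [oV FV VW Vk]] := dim_le_cover dimF oW.
  move=> t _; exists [set j : 'I_k.+1 | `[< G (b j) t >]]%SET => // j; rewrite inE.
  by case: asboolP => // nG; case: (GH (b j) t).
pose side (J : {set I}) := odflt (@finset.set0 'I_k.+1) [pick S in J].
pose piece (X : nat -> set T) (e : bool) j :=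
  \bigcup_(J in [set J : {set I} | #|J| = j.+1 /\
     (inord j \in side J) = e]) @level_set F I V J `&` Phi @^-1` X (b j).
have opiece X e j : (forall i, open (X i)) -> cube_open (piece X e j).
  move=> oX; apply: cube_openI; last exact: cube_open_preimage.
  by apply: cube_open_bigcup => J _; exact: cube_open_level_set.
exists (piece G true), (piece H false); split.
- by move=> j; split; exact: opiece.
- move=> j; apply/seteqP; split=> // x.
  move=> [[[J [cJ sJ] xJ] _] [[J' [cJ' sJ'] xJ'] _]].
  by move: sJ; rewrite (level_set_inj xJ xJ') ?cJ// sJ'.
- by move=> j; split=> x [].
move=> x cx Fx; set J := [set i : I | `[< V i (Phi x) >]]%SET.
have J0 : (0 < #|J|)%N.
  have [i _ Vi] := FV _ Fx; apply/card_gt0P; exists i.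
  by rewrite inE; exact/asboolP.
have Jk : (#|J| <= k.+1)%N by exact: Vk.
(* At most [k.+1] of the [V i] contain [Phi x], so this level is one of the [k.+1] reserved
   pairs. *)
exists #|J|.-1; set j := #|J|.-1.
have xJ : @level_set F I V J x by exact: level_set_self.
have : W (side J) (Phi x).
  apply: VW; split=> //; rewrite /side; case: pickP => [S|/eq_card0 J00].
    by rewrite inE => /asboolP.
  by rewrite J00 in J0.
move=> /(_ (inord j)); rewrite inordK; last by rewrite /j prednK.
case: ifP => jJ ?; [left|right]; split=> //; exists J => //;
  by rewrite /= /j prednK.
Qed.

Lemma not_countable_dimensional_transfer : ~ countable_dimensional T.
Proof.
move=> [F [FT dimF]].
have /choice[P /choice[N PN]] : forall n, exists P N : nat -> set (nat -> R), [/\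
    forall j, cube_open (P j) /\ cube_open (N j),
    forall j, P j `&` N j = set0,
    forall j, P j `<=` Phi @^-1` G (pickle (n, j)) /\
              N j `<=` Phi @^-1` H (pickle (n, j)) &
    forall x, cube x -> F n (Phi x) -> exists j, P j x \/ N j x].
  by move=> n; have [k dimk] := dimF n; exact: dim_le_separation dimk.
have pickle_inj := pcan_inj (@pickleK (nat * nat)%type).
(* [U i] contains [P n j] and misses [N n j]; the condition [x i != 1] keeps it off the opposite
   face. *)
pose U i : set (nat -> R) := [set x |
  (exists n j, pickle (n, j) = i /\ P n j x) \/
  (x i != 1 /\ ~ exists n j, pickle (n, j) = i /\ N n j x)].
have [i x cx xi|i x cx xi|y cy yU] := @cube_transverse R U.
- right; rewrite xi eq_sym oner_eq0; split=> // -[n [j [nj Nx]]].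
  have [_ _ PH _] := PN n; apply: (face0 cx xi).
  by rewrite -nj; apply: (PH j).2.
- rewrite /U /= xi eqxx => -[[n [j [nj Px]]]|[]//].
  have [_ _ PH _] := PN n; apply: (face1 cx xi).
  by rewrite -nj; apply: (PH j).1.
have [n _ Fn] : (\bigcup_n F n) (Phi y) by rewrite FT.
have [oPN PN0 _ PNc] := PN n.
have [j [Py|Ny]] := PNc _ cy Fn.
  have [r r0 rP] := (oPN j).1 y cy Py.
  have [_ [v [/rP Pv []]]] := yU (pickle (n, j)) r r0.
  by left; exists n, j.
have [r r0 rN] := (oPN j).2 y cy Ny.
have [[u [/rN Nu Uu]] _] := yU (pickle (n, j)) r r0.
case: Uu => [[n' [j' [/pickle_inj[-> ->] Pu]]]|[_ []]]; last by exists n, j.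
by have : (P n j `&` N n j) u by []; rewrite PN0.
Qed.

End Transfer.

(** * Features of spaces that are stable under the distance *)

Section DistanceFeatures.
Context {R : realType} {T : choiceType} (d : T -> T -> \bar R).
Variables (Phi : (nat -> R) -> T) (K : nat -> T -> R -> Prop) (delta : nat -> R).
Hypothesis Phi_continuous : forall x e, cube x -> 0 < e ->
  exists2 r, 0 < r & forall y, cube_ball r x y -> (d (Phi x) (Phi y) < e%:E)%E.
Hypothesis K_le : forall i X s t, s <= t -> K i X s -> K i X t.
Hypothesis K_dist : forall i X Y e t, (d X Y < e%:E)%E ->
  (K i X t -> K i Y (t + 3 * e)) /\ (K i Y t -> K i X (t + 3 * e)).
Hypothesis delta_gt0 : forall i, 0 < delta i.
Hypothesis K_face1 : forall i x, cube x -> x i = 1 -> K i (Phi x) 0.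
Hypothesis K_face0 : forall i x, cube x -> x i = 0 -> ~ K i (Phi x) (delta i).

(** [K i X t] reads: [X] has feature [i] up to error [t]. Its failure at some positive error and its
    presence at some error below [delta i] are open conditions that cover the space. *)
Lemma infinite_dimensional_dist_space :
  strongly_infinite_dimensional (dist_space d) /\
  ~ countable_dimensional (dist_space d).
Proof.
pose G i : set (dist_space d) := [set X | exists2 t, 0 < t & ~ K i X t].
pose H i : set (dist_space d) := [set X | exists2 t, t < delta i & K i X t].
have cPhi x (V : set (dist_space d)) : cube x -> open V -> V (Phi x) ->
    exists2 r, 0 < r & cube_ball r x `<=` Phi @^-1` V.
  move=> cx oV Vx; have [e e0 eV] := oV _ Vx.
  by have [r r0 rd] := Phi_continuous cx e0; exists r => // y /rd/eV.
have oG i : open (G i).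
  (* A sixth, because [t / 2 + 3 * (t / 6) = t]. *)
  move=> X [t t0 nKt]; exists (t / 6); first by rewrite divr_gt0.
  move=> Y XY; exists (t / 2); first by rewrite divr_gt0.
  move=> KY; apply: nKt; have [_ /(_ KY)] := K_dist i (t / 2) XY.
  by apply: K_le; lra.
have oH i : open (H i).
  move=> X [t tdelta Kt]; exists ((delta i - t) / 6).
    by rewrite divr_gt0// subr_gt0.
  move=> Y XY; exists (t + 3 * ((delta i - t) / 6)); first by lra.
  by have [/(_ Kt)] := K_dist i t XY.
have GH i X : G i X \/ H i X.
  have [KX|nKX] := pselect (K i X (delta i / 2)); [right|left].
    by exists (delta i / 2) => //; have := delta_gt0 i; lra.
  by exists (delta i / 2) => //; rewrite divr_gt0.
have f0 i x : cube x -> x i = 0 -> ~ H i (Phi x).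
  move=> cx xi [t td Kt]; apply: (K_face0 cx xi); apply: K_le Kt; exact: ltW.
have f1 i x : cube x -> x i = 1 -> ~ G i (Phi x).
  by move=> cx xi [t t0]; apply; apply: K_le (K_face1 cx xi); exact: ltW.
split; first exact: (strongly_infinite_dimensional_transfer cPhi oG oH GH f0 f1).
exact: (not_countable_dimensional_transfer cPhi oG oH GH f0 f1).
Qed.

End DistanceFeatures.

(** * Stars *)

Section Star.
Context {R : realType}.
Implicit Types (x y : nat -> R).

(* The truncation only serves to make [star x] a metric space for every [x]. *)
Definition leg x n : R :=
  if n is k.+1 then 4^-1 ^+ k * (1 + Num.min `|x k| 1) else 0.

Definition star x : Type := nat.

(** With the maximum instead of the sum, every distance is the length of a leg. *)
Definition star_dist x (m n : star x) : R :=
  if m == n :> nat then 0 else Num.max (leg x m) (leg x n).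

Lemma leg_ge x k : 4^-1 ^+ k <= leg x k.+1.
Proof.
by rewrite /= ler_peMr ?exprn_ge0 ?invr_ge0// lerDl le_min normr_ge0 ler01.
Qed.

Lemma leg_le x k : leg x k.+1 <= 2 * 4^-1 ^+ k.
Proof.
rewrite /= mulrC ler_wpM2r ?exprn_ge0 ?invr_ge0//.
by rewrite -[2]/(1 + 1) lerD2l ge_min lexx orbT.
Qed.

Lemma leg_cube x k : cube x -> leg x k.+1 = 4^-1 ^+ k * (1 + x k).
Proof.
move=> cx; rewrite /=; congr (_ * (_ + _)); have /andP[x0 x1] := cx k.
by rewrite ger0_norm// min_l.
Qed.

Lemma leg_gt0 x k : 0 < leg x k.+1.
Proof. by rewrite (lt_le_trans _ (leg_ge x k))// exprn_gt0// invr_gt0. Qed.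

Lemma leg_ge0 x n : 0 <= leg x n.
Proof. by case: n => // k; exact/ltW/leg_gt0. Qed.

Lemma leg_small x (e : R) : 0 < e -> 
  exists N, forall n, (N <= n)%N -> leg x n < e.
Proof.
move=> e0; exists (Num.bound (2 / e)).+1 => -[//|k] Nk.
rewrite (le_lt_trans (leg_le x k))// exprVn -natrX.
rewrite ltr_pdivrMr ?ltr0n ?expn_gt0// mulrC -ltr_pdivrMr//.
have eN : 2 / e < (Num.bound (2 / e))%:R.
  by rewrite archi_boundP// divr_ge0// ltW.
by rewrite (lt_trans eN)// ltr_nat (leq_ltn_trans _ (ltn_expl k _)).
Qed.

Lemma star_distxx x (m : star x) : star_dist m m = 0.
Proof. by rewrite /star_dist eqxx. Qed.

Lemma star_dist_eq0 x (m n : star x) : star_dist m n = 0 -> m = n.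
Proof.
rewrite /star_dist; case: eqP => // mn /eqP; rewrite eq_le ge_max => /andP[].
case: m mn => [|k] mn; last by rewrite leNgt leg_gt0.
by case: n mn => [//|k] mn; rewrite andbC leNgt leg_gt0.
Qed.

Lemma star_dist_sym x (m n : star x) : star_dist m n = star_dist n m.
Proof. by rewrite /star_dist eq_sym maxC. Qed.

Lemma star_dist_triangle x (n m p : star x) :
  star_dist m p <= star_dist m n + star_dist n p.
Proof.
rewrite /star_dist; have [->|mp] := eqVneq (m : nat) p.
  by rewrite addr_ge0//; case: ifP => // _; rewrite le_max leg_ge0.
have [<-|mn] := eqVneq (m : nat) n; first by rewrite add0r (negbTE mp).
have [<-|np] := eqVneq (n : nat) p; first by rewrite addr0.
by rewrite ge_max; apply/andP; split; [apply: ler_wpDr|apply: ler_wpDl];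
  rewrite le_max ?leg_ge0// lexx ?orbT.
Qed.

HB.instance Definition _ x := Choice.on (star x).
HB.instance Definition _ x := isPointed.Build (star x) 0%N.
HB.instance Definition _ x := @isMetric.Build R (star x) (@star_dist x)
  (@star_distxx x) (@star_dist_eq0 x) (@star_dist_sym x)
  (@star_dist_triangle x).

Lemma star_mdist x (m n : star x) : mdist m n = star_dist m n.
Proof. by []. Qed.

(** Legs tend to 0, so a filter that does not cluster at the centre contains a finite set. *)
Lemma star_compact x : compact [set: star x].
Proof.
move=> F PF FT; have [|ncl] := pselect (cluster F (0%N : star x)).
  by exists 0%N.
have [A [B [FA nB AB]]] : exists A B : set (star x),
    [/\ F A, nbhs (0%N : star x) B & A `&` B = set0].
  apply: contrapT => nAB; apply: ncl => A B FA nB; apply: contrapT => AB.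
  by apply: nAB; exists A, B; split=> //; apply/eqP/negPn/negP => /set0P.
have [e /= e0 eB] : exists2 e, 0 < e & ball (0%N : star x) e `<=` B.
  by move/nbhs_ballP : nB.
have [N Nr] := leg_small x e0.
have FN : F [set n : star x | (n < N)%N].
  apply: filterS FA => n An; rewrite /= ltnNge; apply/negP => /Nr ne.
  have : (A `&` B) n.
    split=> //; apply: eB; rewrite ballEmdist /= star_mdist /star_dist.
    by case: ifP => // _; rewrite gt_max e0.
  by rewrite AB.
have finN : finite_set [set n : star x | (n < N)%N] by exact: finite_II.
by have [p [_ clp]] := finite_compact finN PF FN; exists p.
Qed.


Lemma star_complete x (F : set_system (star x)) :
  ProperFilter F -> cauchy F -> cvg F.
Proof.
move=> PF cF; apply: (compact_cauchy_cvg PF cF filterT); exact: star_compact.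
Qed.

HB.instance Definition _ x := Uniform_isComplete.Build (star x)
  (@star_complete x).

Definition compact_star x : compactMetricSpace R :=
  @CompactMetricSpace R (star x) (PointedMetric.class (star x))
    (@star_compact x).

End Star.

(** * Measures on the stars *)

Section NatImage.
Context {R : realType}.
Local Open Scope ereal_scope.

(** The Poisson law is a ready-made probability that charges every integer. *)
Definition nat_mass : probability nat R := poisson_prob 1 0.

Lemma nat_mass_gt0 n (A : set nat) : A n -> 0 < nat_mass A.
Proof.
move=> An; apply: (@lt_le_trans _ _ (nat_mass [set n])); last first.
  by apply: le_measure; rewrite ?inE//= => _ ->.
rewrite /nat_mass /= /poisson_prob ltr01 esum_set1 ?lee_fin ?poisson_pmf_ge0//.
by rewrite lte_fin /poisson_pmf ltr01 !mulr_gt0 ?expR_gt0// invr_gt0 ltr0n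
  fact_gt0.
Qed.

Section Fun.
Context {d : measure_display} {T : measurableType d}.

(** An alias to which the structure of measurable function is attached. *)
Definition nat_fun (f : nat -> T) := f.

Lemma nat_fun_measurable f : measurable_fun setT (nat_fun f).
Proof. by []. Qed.

HB.instance Definition _ f := isMeasurableFun.Build _ _ nat T (nat_fun f)
  (nat_fun_measurable f).

(** Gives both the measure of a star and the diagonal coupling of two stars. *)
Definition nat_image (f : nat -> T) : probability T R :=
  distribution nat_mass (nat_fun f).

Lemma nat_imageE f A : nat_image f A = nat_mass (f @^-1` A).
Proof. by []. Qed.

End Fun.
End NatImage.

Section Spaces.
Context {R : realType}.
Implicit Types x : nat -> R.

Definition star_measure x : probability (borel (star x)) R :=
  nat_image (fun n => n : borel (star x)).

Lemma star_separable x : exists2 D : set (star x), countable D & dense D.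
Proof.
exists setT; first exact: countableP.
by move=> A [a Aa] _; exists a.
Qed.

Lemma star_supp x : supp (star_measure x) = setT.
Proof.
by apply/seteqP; split=> // n _ U _ Un; exact: (@nat_mass_gt0 R n U).
Qed.

Definition mm_star x : mmSpace R :=
  @MMSpace R (star x) (CompleteMetric.class (star x)) (star_separable x)
    (star_measure x) (star_supp x).

End Spaces.

(** * The Gromov-Hausdorff space *)

Section StarFeatures.
Context {R : realType}.
Implicit Types (x y : nat -> R).

(** The factor [4^-1 ^+ k] absorbs the weight [k.+1] of [cube_ball]. *)
Lemma leg_lip x y r n : cube x -> cube_ball r x y ->
  `|leg x n - leg y n| <= r.
Proof.
move=> cx [cy xy].
have r0 : 0 <= r by have := xy 0%N; rewrite mulr1; apply: le_trans.
case: n => [|k]; first by rewrite subrr normr0.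
rewrite !leg_cube// -mulrBr opprD addrACA subrr add0r normrM.
rewrite ger0_norm ?exprn_ge0 ?invr_ge0// exprVn mulrC ler_pdivrMr ?exprn_gt0//.
by rewrite (le_trans (xy k))// ler_wpM2l// -natrX ler_nat ltn_expl.
Qed.

Lemma star_lip x y r (m n : nat) : cube x -> cube_ball r x y ->
  `|mdist (m : star x) n - mdist (m : star y) n| <= r.
Proof.
move=> cx xy; rewrite !star_mdist /star_dist.
have := leg_lip m cx xy; have := leg_lip n cx xy.
case: ifP => _; first by move=> rn _; rewrite subrr normr0 (le_trans _ rn).
move: (leg x m) (leg y m) (leg x n) (leg y n) => a b c d.
rewrite !ler_norml => /andP[? ?] /andP[? ?].
by case: (leP a c); case: (leP b d) => ? ?; apply/andP; split; lra.
Qed.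

Lemma star_face1 x i : cube x -> x i = 1 ->
  mdist (i.+1 : star x) i.+2 = 2 * 4^-1 ^+ i.
Proof.
move=> cx xi; rewrite star_mdist /star_dist ifF; last by apply/negbTE; lia.
rewrite leg_cube// xi mulrC max_l// (le_trans (leg_le x i.+1))//.
by rewrite exprS ler_pM2l// ler_piMl ?exprn_ge0// ?invr_ge0// invf_le1 ?ler1n.
Qed.

(** With [q = 4^-1 ^+ i], the [i]-th leg has length [q], earlier ones at least [4 * q], later ones
    at most [q / 2]: all are at least [q] away from [2 * q]. *)
Lemma leg_face0 x i n : cube x -> x i = 0 ->
  4^-1 ^+ i <= `|leg x n - 2 * 4^-1 ^+ i|.
Proof.
move=> cx xi; set q := 4^-1 ^+ i.
have q0 : 0 < q by rewrite exprn_gt0// invr_gt0.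
have c0 : 0 <= 4^-1 :> R by rewrite invr_ge0.
have c1 : 4^-1 <= 1 :> R by rewrite invf_le1// ler1n.
case: n => [|k]; first by rewrite /= ler_normr; apply/orP; right; lra.
have [ki|ik|->] := ltngtP k i.
- rewrite ler_normr; apply/orP; left; have rk := leg_ge x k.
  by have := ler_wiXn2l c0 c1 ki; rewrite exprS -/q; lra.
- rewrite ler_normr; apply/orP; right; have rk := leg_le x k.
  by have := ler_wiXn2l c0 c1 ik; rewrite exprS -/q; lra.
- by rewrite leg_cube// xi addr0 mulr1 -/q ler_normr; apply/orP; right; lra.
Qed.

Lemma star_face0 x i (m n : star x) : cube x -> x i = 0 ->
  4^-1 ^+ i <= `|mdist m n - 2 * 4^-1 ^+ i|.
Proof.
move=> cx xi; rewrite star_mdist /star_dist; case: ifP => _.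
  exact: (leg_face0 0 cx xi).
by case: (leP (leg x m)) => _; exact: leg_face0.
Qed.

End StarFeatures.

Section Distortion.
Context {R : realType} {X Y : metricType R}.

Lemma dis_ge (S : set (X * Y)) p q : S p -> S q ->
  (`|mdist p.1 q.1 - mdist p.2 q.2|%:E <= dis S)%E.
Proof.
by move=> Sp Sq; apply: ereal_sup_ubound; right; exists p => //; exists q.
Qed.

Lemma dis_le (S : set (X * Y)) (r : R) : 0 <= r ->
  (forall p q, S p -> S q -> `|mdist p.1 q.1 - mdist p.2 q.2| <= r) ->
  (dis S <= r%:E)%E.
Proof.
move=> r0 Sr; apply: ge_ereal_sup => _ [->|[p Sp [q Sq <-]]]; rewrite lee_fin//.
exact: Sr.
Qed.

Lemma dis_ge0 (S : set (X * Y)) : (0 <= dis S)%E.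
Proof. by apply: ereal_sup_ubound; left. Qed.

End Distortion.

Section GHFeatures.
Context {R : realType}.
Implicit Types x : nat -> R.

Definition gh_star x : {eq_quot @isometric R} :=
  \pi_{eq_quot @isometric R} (compact_star x).

Lemma gh_star_isometry x :
  exists f : star x -> repr (gh_star x), Defs.isometry f.
Proof.
have : isometric (compact_star x) (repr (gh_star x)).
  by apply/eqmodP; rewrite reprK.
by move=> /asboolP.
Qed.

Definition gh_feature i (X : {eq_quot @isometric R}) (t : R) :=
  exists u v : repr X, `|mdist u v - 2 * 4^-1 ^+ i| <= t.

Theorem gh_space_infinite_dimensional :
  strongly_infinite_dimensional (gh_space R) /\
  ~ countable_dimensional (gh_space R).
Proof.
apply: (@infinite_dimensional_dist_space R _ _ gh_star gh_feature
  (fun i => 4^-1 ^+ i / 2)).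
- move=> x e cx e0; exists e => // y xy.
  have [f [fd fr]] := gh_star_isometry x; have [g [gd gr]] := gh_star_isometry y.
  pose S : set (repr (gh_star x) * repr (gh_star y)) := range (fun n => (f n, g n)).
  have Se : (dis S <= e%:E)%E.
    apply: dis_le; first exact: ltW.
    by move=> _ _ [m _ <-] [n _ <-] /=; rewrite fd gd; exact: star_lip.
  apply: (@le_lt_trans _ _ (2^-1%:E * e%:E)%E); last first.
    by rewrite -EFinM lte_fin; lra.
  rewrite /gh_class_dist /gh_dist lee_wpmul2l ?lee_fin ?invr_ge0//.
  apply: le_trans Se; apply: ereal_inf_lbound; exists S => //; split.
    by apply/seteqP; split=> // u _; have [n _ <-] : range f u by [rewrite fr];
      exists (f n, g n) => //; exists n.
  by apply/seteqP; split=> // u _; have [n _ <-] : range g u by [rewrite gr];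
    exists (f n, g n) => //; exists n.
- by move=> i X s t st [u [v uv]]; exists u, v; exact: le_trans st.
- move=> i X Y e t; rewrite /gh_class_dist /gh_dist => XYe.
  (* The factor [2^-1] in the distance allows distortion up to [2 * e], within the permitted loss
     [3 * e]. *)
  have [S [S1 S2] Se] : exists2 S, @correspondence R (repr X) (repr Y) S &
      (dis S < (2 * e)%:E)%E.
    have : (ereal_inf [set dis S | S in @correspondence R (repr X) (repr Y)] <
        (2 * e)%:E)%E.
      rewrite ltNge; apply/negP => /(lee_wpmul2l (x := 2^-1%:E)).
      rewrite lee_fin invr_ge0 -EFinM mulKf ?pnatr_eq0// => /(_ (ler0n _ 2)).
      by rewrite leNgt XYe.
    by move=> /ereal_inf_lt[_ [S cS <-] Se]; exists S.
  have Sd p q : S p -> S q -> `|mdist p.1 q.1 - mdist p.2 q.2| < 2 * e.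
    by move=> Sp Sq; rewrite -lte_fin (le_lt_trans (dis_ge Sp Sq)).
  have e0 : 0 < 2 * e by rewrite -lte_fin (le_lt_trans (dis_ge0 S)).
  have lip (a b c : R) : `|a - c| <= t -> `|a - b| < 2 * e -> `|b - c| <= t + 3 * e.
    rewrite !ler_norml ltr_norml => /andP[? ?] /andP[? ?].
    by apply/andP; split; lra.
  split=> -[u [v uv]].
    have [p Sp pu] : (fst @` S) u by rewrite S1.
    have [q Sq qv] : (fst @` S) v by rewrite S1.
    exists p.2, q.2; apply: lip uv _; rewrite -pu -qv; exact: Sd.
  have [p Sp pu] : (snd @` S) u by rewrite S2.
  have [q Sq qv] : (snd @` S) v by rewrite S2.
  exists p.1, q.1; apply: lip uv _; rewrite -pu -qv distrC; exact: Sd.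
- by move=> i; rewrite divr_gt0// exprn_gt0// invr_gt0.
- move=> i x cx xi; have [f [fd _]] := gh_star_isometry x.
  exists (f i.+1), (f i.+2); rewrite fd star_face1// subrr normr0//.
- move=> i x cx xi [u [v]]; have [f [fd fr]] := gh_star_isometry x.
  have [m _ <-] : range f u by rewrite fr.
  have [n _ <-] : range f v by rewrite fr.
  rewrite fd; have := star_face0 m n cx xi.
  have : 0 < 4^-1 ^+ i :> R by rewrite exprn_gt0// invr_gt0.
  lra.
Qed.

End GHFeatures.

(** * The box space *)

Section MetricSpaces.
Context {R : realType} {X : metricType R}.

Lemma open_mdist_lt (u : X) (e : R) : open [set v | mdist u v < e].
Proof.
rewrite openE => v /= uv; apply/nbhs_ballP.
exists (e - mdist u v) => /=; first by rewrite subr_gt0.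
move=> z; rewrite ballEmdist /= => vz.
by rewrite (le_lt_trans (metric_triangle _ v _))// -ltrBrDl.
Qed.

Lemma mdist_lip (u v a b : X) :
  `|mdist u v - mdist a b| <= mdist u a + mdist v b.
Proof.
rewrite ler_norml; apply/andP; split.
  have := metric_triangle a u b; have := metric_triangle u v b.
  by rewrite (metric_sym a u); lra.
have := metric_triangle u a v; have := metric_triangle a b v.
by rewrite (metric_sym b v); lra.
Qed.

Lemma mdist_continuous (a : X) : continuous (fun u : X => mdist u a).
Proof.
move=> u; apply/cvg_ballP => e e0; apply: filterS (nbhsx_ballx u e e0) => v.
rewrite !ballEmdist /= => uv; rewrite /ball /= (le_lt_trans (mdist_lip _ _ _ _))//.
by rewrite mdistxx addr0.
Qed.

End MetricSpaces.

Section BoxFeatures.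
Context {R : realType}.

(** The mass bound keeps the two sets from being discarded in the box distance. *)
Definition mm_feature (w c t : R) (X : mmSpace R) :=
  exists A B : set X, [/\ open A /\ open B,
    ((w - t)%:E <= mm_measure X A)%E, ((w - t)%:E <= mm_measure X B)%E &
    forall a b, A a -> B b -> `|mdist a b - c| <= t].

Lemma mm_feature_le w c s t X : s <= t ->
  mm_feature w c s X -> mm_feature w c t X.
Proof.
move=> st [A [B [oAB wA wB cAB]]]; exists A, B; split=> //.
- by apply: le_trans wA; rewrite lee_fin lerD2l lerN2.
- by apply: le_trans wB; rewrite lee_fin lerD2l lerN2.
- by move=> a b Aa Bb; rewrite (le_trans (cAB _ _ Aa Bb)).
Qed.

(** Sets are carried along [S] and thickened by [e] to become open. This loses at most the mass [e]
    outside [S], and shifts distances by [e] for [S] plus [e] for each thickening. Abstract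
    projections allow both directions. *)
Lemma mm_feature_coupling (X Y : mmSpace R) d (Z : measurableType d)
    (pi : {measure set Z -> \bar R}) (p : Z -> X) (q : Z -> Y) (S : set Z)
    (w c e t : R) :
  (forall A : set X, open A ->
    measurable (p @^-1` A) /\ pi (p @^-1` A) = mm_measure X A) ->
  (forall B : set Y, open B ->
    measurable (q @^-1` B) /\ pi (q @^-1` B) = mm_measure Y B) ->
  measurable S -> (1 - pi S < e%:E)%E -> 0 < e ->
  (forall r s, S r -> S s -> `|mdist (p r) (p s) - mdist (q r) (q s)| <= e) ->
  mm_feature w c t X -> mm_feature w c (t + 3 * e) Y.
Proof.
move=> pX qY mS pS e0 Sd [A [B [[oA oB] wA wB cAB]]].
pose img (C : set X) : set Y :=
  \bigcup_(s in S `&` p @^-1` C) [set y | mdist (q s) y < e].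
have oimg C : open (img C) by apply: bigcup_open => s _; exact: open_mdist_lt.
have pT : pi setT = 1%E.
  have [_] := pX setT openT; rewrite preimage_setT => ->.
  exact: probability_setT.
have pSC : (pi (~` S) < e%:E)%E.
  have SSC : (pi S + pi (~` S) = 1)%E.
    rewrite -measureU//; [|exact: measurableC|exact: setICr].
    by rewrite setUv; exact: pT.
  have Sfin : pi S \is a fin_num.
    rewrite ge0_fin_numE// (@le_lt_trans _ _ 1%E) ?ltry//.
    by rewrite -SSC leeDl.
  by move: pS; rewrite -SSC addeAC subee// add0e.
have wimg C : open C -> ((w - t)%:E <= mm_measure X C)%E ->
    ((w - (t + 3 * e))%:E <= mm_measure Y (img C))%E.
  move=> oC wC; apply: (@le_trans _ _ ((w - t)%:E - e%:E)%E).
    by rewrite -EFinB lee_fin; lra.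
  rewrite leeBlDr// (le_trans wC)//.
  have [mpC <-] := pX C oC; have [mqC <-] := qY _ (oimg C).
  apply: (@le_trans _ _ (pi (q @^-1` img C `|` ~` S))).
    apply: le_measure; rewrite ?inE//.
      by apply: measurableU => //; exact: measurableC.
    move=> s Cs; have [Ss|nSs] := pselect (S s); [left|by right].
    by exists s => //=; rewrite mdistxx.
  apply: le_trans (measureU2 _ _ _) _ => //; first exact: measurableC.
  by rewrite leeD2l// ltW.
exists (img A), (img B); split=> //; [exact: wimg|exact: wimg|].
move=> a b [r [Sr Ar] /= ra] [s [Ss Bs] /= sb].
have := mdist_lip (q r) (q s) a b; have := Sd _ _ Sr Ss.
have := cAB _ _ Ar Bs; rewrite !ler_norml => /andP[? ?] /andP[? ?] /andP[? ?].
by apply/andP; split; lra.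
Qed.

Lemma mm_feature_box (X Y : mmSpace R) (w c e t : R) : (box_dist X Y < e%:E)%E ->
  (mm_feature w c t X -> mm_feature w c (t + 3 * e) Y) /\
  (mm_feature w c t Y -> mm_feature w c (t + 3 * e) X).
Proof.
move=> /ereal_inf_lt[_ [pi [pX pY] <-]] /ereal_inf_lt[_ [S cS <-]].
rewrite gt_max => /andP[pS Se].
have e0 : 0 < e by rewrite -lte_fin (le_lt_trans (dis_ge0 S)).
have mfst (A : set X) : open A ->
    measurable (fst @^-1` A : set (borel (X * Y)%type)) /\
    pi (fst @^-1` A) = mm_measure X A.
  move=> oA; split; last by apply: pX; exact: sub_sigma_algebra.
  by apply: sub_sigma_algebra; apply: open_comp => // z _; exact: cvg_fst.
have msnd (A : set Y) : open A ->
    measurable (snd @^-1` A : set (borel (X * Y)%type)) /\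
    pi (snd @^-1` A) = mm_measure Y A.
  move=> oA; split; last by apply: pY; exact: sub_sigma_algebra.
  by apply: sub_sigma_algebra; apply: open_comp => // z _; exact: cvg_snd.
have mS : measurable (S : set (borel (X * Y)%type)).
  rewrite -[S]setCK; apply: measurableC; apply: sub_sigma_algebra.
  exact: closed_openC.
have Sd r s : S r -> S s -> `|mdist r.1 s.1 - mdist r.2 s.2| <= e.
  by move=> Sr Ss; rewrite -lee_fin (le_trans (dis_ge Sr Ss))// ltW.
split; first exact: (mm_feature_coupling mfst msnd mS pS e0 Sd).
apply: (mm_feature_coupling msnd mfst mS pS e0) => r s Sr Ss.
by rewrite distrC; exact: Sd.
Qed.

End BoxFeatures.

Section BoxStar.
Context {R : realType}.
Implicit Types x y : nat -> R.

Definition box_star x : {eq_quot @mm_isomorphic R} :=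
  \pi_{eq_quot @mm_isomorphic R} (mm_star x).

Lemma box_star_isomorphism x :
  exists f : star x -> repr (box_star x), Defs.isometry f /\
    forall B : set (borel (repr (box_star x))), measurable B ->
      mm_measure (repr (box_star x)) B = nat_mass (f @^-1` B).
Proof.
have : mm_isomorphic (mm_star x) (repr (box_star x)).
  by apply/eqmodP; rewrite reprK.
by move=> /asboolP[f [fi fm]]; exists f; split.
Qed.

Let mass n : R := fine (nat_mass [set n]).

Let massE n : ((mass n)%:E = nat_mass [set n])%E.
Proof. by rewrite fineK// fin_num_measure. Qed.

Let mass_gt0 n : 0 < mass n.
Proof. by rewrite -lte_fin massE; exact: nat_mass_gt0. Qed.

(** The points [i.+1] and [i.+2] realize the distance of [star_face1]. *)
Let weight i := Num.min (mass i.+1) (mass i.+2).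

Let weight_gt0 i : 0 < weight i.
Proof. by rewrite lt_min !mass_gt0. Qed.

Lemma star_ball x n (m : star x) :
  mdist (n.+1 : star x) m < 4^-1 ^+ n -> m = n.+1.
Proof.
rewrite star_mdist /star_dist; case: eqP => [->//|_].
by rewrite gt_max ltNge leg_ge.
Qed.

Lemma mm_feature_face1 i x : cube x -> x i = 1 ->
  mm_feature (weight i) (2 * 4^-1 ^+ i) 0 (repr (box_star x)).
Proof.
move=> cx xi; have [f [[fd fr] fm]] := box_star_isomorphism x.
pose A n : set (repr (box_star x)) := [set v | mdist (f n.+1) v < 4^-1 ^+ n].
have oA n : open (A n) by exact: open_mdist_lt.
have AE n v : A n v -> v = f n.+1.
  have [m _ <-] : range f v by rewrite fr.
  by rewrite /A /= fd => /star_ball ->.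
have wA n : ((mass n.+1)%:E <= mm_measure (repr (box_star x)) (A n))%E.
  rewrite fm ?massE; last exact: sub_sigma_algebra.
  apply: le_measure; rewrite ?inE// => _ ->.
  by rewrite /A /= mdistxx exprn_gt0// invr_gt0.
exists (A i), (A i.+1); rewrite subr0; split=> //.
- by apply: le_trans (wA i); rewrite lee_fin ge_min lexx.
- by apply: le_trans (wA i.+1); rewrite lee_fin ge_min lexx orbT.
- by move=> _ _ /AE -> /AE ->; rewrite fd star_face1// subrr normr0.
Qed.

(** An error below [weight i] makes both sets non-empty; one below [4^-1 ^+ i] then contradicts
    [star_face0]. *)
Lemma mm_feature_face0 i x : cube x -> x i = 0 ->
  ~ mm_feature (weight i) (2 * 4^-1 ^+ i)
     (Num.min (4^-1 ^+ i / 2) (weight i / 2)) (repr (box_star x)).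
Proof.
move=> cx xi; have [f [[fd fr] fm]] := box_star_isomorphism x.
set t := Num.min _ _; move=> [A [B [oAB wA wB AB]]].
have q0 : 0 < 4^-1 ^+ i :> R by rewrite exprn_gt0// invr_gt0.
have tq : t <= 4^-1 ^+ i / 2 by rewrite ge_min lexx.
have tw : t <= weight i / 2 by rewrite ge_min lexx orbT.
have nonempty (C : set (repr (box_star x))) :
    ((weight i - t)%:E <= mm_measure (repr (box_star x)) C)%E -> C !=set0.
  move=> wC; apply/set0P/eqP => C0; move: wC; rewrite C0 measure0 lee_fin.
  by have := weight_gt0 i; lra.
have [a Aa] := nonempty A wA; have [b Bb] := nonempty B wB.
have := AB a b Aa Bb.
have [m _ <-] : range f a by rewrite fr.
have [n _ <-] : range f b by rewrite fr.
by rewrite fd; have := star_face0 m n cx xi; lra.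
Qed.

(* The closed set of the box distance consists of the pairs whose distances to
   corresponding points of the two stars almost agree; it carries the whole
   mass of the diagonal coupling. *)
Lemma box_star_le x y (r : R) : cube x -> cube_ball r x y ->
  (box_class_dist (box_star x) (box_star y) <= (3 * r)%:E)%E.
Proof.
move=> cx xy; have r0 : 0 <= r.
  by have := star_lip 0 0 cx xy; apply: le_trans.
have [f [[fd fr] fm]] := box_star_isomorphism x.
have [g [[gd gr] gm]] := box_star_isomorphism y.
set X := repr (box_star x); set Y := repr (box_star y).
pose pi := nat_image (R := R) (fun n => (f n, g n) : borel (X * Y)%type).
pose S : set (X * Y) :=
  \bigcap_(k in [set: nat]) [set p | `|mdist p.1 (f k) - mdist p.2 (g k)| <= r].
have cS : closed S.
  apply: closed_bigI => k _.
  pose h (p : X * Y) := mdist p.1 (f k) - mdist p.2 (g k).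
  have ch : continuous h.
    move=> p; apply: cvgB.
      exact: (@continuous_comp _ _ _ fst (fun u : X => mdist u (f k)) p
        (@cvg_fst _ _ _ _ _) (@mdist_continuous _ _ _ _)).
    exact: (@continuous_comp _ _ _ snd (fun u : Y => mdist u (g k)) p
      (@cvg_snd _ _ _ _ _) (@mdist_continuous _ _ _ _)).
  rewrite (_ : mkset _ = h @^-1` [set a | `|a| <= r])//.
  apply: preimage_closed => [p _|]; first exact: ch.
  rewrite (_ : mkset _ = Num.norm @^-1` [set a | a <= r])//.
  apply: preimage_closed => [a _|]; last exact: closed_le.
  exact: (@norm_continuous R R).
have Sfg n : S (f n, g n) by move=> k _; rewrite /= fd gd; exact: star_lip.
have dS : (dis S <= (3 * r)%:E)%E.
  apply: dis_le; first by rewrite mulr_ge0.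
  move=> [u v] [u' v'] Sp Sq /=.
  have [m _ um] : range f u by rewrite fr.
  have [n _ vn] : range g v by rewrite gr.
  have [m' _ um'] : range f u' by rewrite fr.
  (* Three errors of [r]: from [u, u'] to [v, g m'], on to [f n, u'] by comparing the stars, and on
     to [v, v']. *)
  have := Sp m' I; have := Sq n I; have := star_lip n m' cx xy.
  rewrite /= -fd -gd um' vn (metric_sym u') (metric_sym v').
  rewrite !ler_norml => /andP[? ?] /andP[? ?] /andP[? ?].
  by apply/andP; split; lra.
have piXY : coupling (X := X) (Y := Y) pi.
  split=> [A mA|B mB]; first by rewrite fm.
  by rewrite gm.
apply: (@le_trans _ _ (maxe (1 - pi S) (dis S))%E); last first.
  rewrite ge_max dS andbT (_ : pi S = 1%E) ?subee// ?lee_fin ?mulr_ge0//.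
  rewrite /pi nat_imageE (_ : _ @^-1` _ = setT) ?probability_setT//.
  by apply/seteqP; split=> // n _; exact: Sfg.
apply: le_trans (ereal_inf_lbound _) _; first by exists pi; first exact: piXY.
by apply: ereal_inf_lbound; exists S.
Qed.

Theorem box_space_infinite_dimensional :
  strongly_infinite_dimensional (box_space R) /\
  ~ countable_dimensional (box_space R).
Proof.
apply: (@infinite_dimensional_dist_space R _ _ box_star
  (fun i X t => mm_feature (weight i) (2 * 4^-1 ^+ i) t (repr X))
  (fun i => Num.min (4^-1 ^+ i / 2) (weight i / 2))).
- move=> x e cx e0; exists (e / 4); first by rewrite divr_gt0.
  move=> y xy; apply: le_lt_trans (box_star_le cx xy) _.
  by rewrite lte_fin; lra.
- by move=> i X s t; exact: mm_feature_le.
- by move=> i X Y e t; exact: mm_feature_box.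
- by move=> i; rewrite lt_min !divr_gt0// exprn_gt0// invr_gt0.
- by move=> i x; exact: mm_feature_face1.
- by move=> i x; exact: mm_feature_face0.
Qed.

End BoxStar.

Theorem mainTheorem3 (R : realType) :
  (strongly_infinite_dimensional (gh_space R) /\
   strongly_infinite_dimensional (box_space R)) /\
  (~ countable_dimensional (gh_space R) /\
   ~ countable_dimensional (box_space R)).
Proof.
have [gh ngh] := @gh_space_infinite_dimensional R.
by have [box nbox] := @box_space_infinite_dimensional R.
Qed.
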